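(* Let $K$ be a field of characteristic $0$, $\mathbf{x}=(x_1,\dots,x_d)$, $\mathbf{z}=(z_1,\dots,z_l)$, and let $f\in F=K(\mathbf{x})[[\mathbf{z}]]$ be D-finite, with $r=\dim_{K(\mathbf{x},\mathbf{z})}\mathbb{A}'.f$. Let $B=(b_1.f,\dots,b_r.f)$, $b_i\in\mathbb{A}'$, be a basis of $\mathbb{A}'.f$ over $K(\mathbf{x},\mathbf{z})$, and for each $v\in\mathbb{Z}^d$ let $\mathcal{M}^f_v$ be the unique matrix in $\mathrm{GL}_r(K(\mathbf{x},\mathbf{z}))$ satisfying $$(b_1.f,\dots,b_r.f)\cdot\mathcal{M}^f_v=(S_vb_1.f,\dots,S_vb_r.f)=\sigma_v\big((b_1.f,\dots,b_r.f)\big).$$ Then $v\mapsto\mathcal{M}^f_v$ is a conservative matrix field of dimension $d$ and rank $r$ over the field $K(\mathbf{z})$; i.e. $\mathcal{M}^f_{v+w}=\mathcal{M}^f_v\cdot\sigma_v(\mathcal{M}^f_w)$ for all $v,w\in\mathbb{Z}^d$.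
   Context: $\mathbb{A}'=K(\mathbf{x},\mathbf{z})[S_{x_1}^{\pm1},\dots,S_{x_d}^{\pm1},\theta_{z_1},\dots,\theta_{z_l}]$ is the Ore algebra where $S_{x_i}$ is the shift $x_i\mapsto x_i+1$ (so $S_{x_i}g(\mathbf{x},\mathbf{z})=g(\mathbf{x}+e_i,\mathbf{z})S_{x_i}$), $\theta_{z_j}=z_j\frac{\partial}{\partial z_j}$ is the Euler derivative, all generators commute pairwise, and it acts on $F$ in the natural way; $L.f$ denotes the action of $L$ on $f$, and $\mathbb{A}'.f=\{L.f:L\in\mathbb{A}'\}$. For $v\in\mathbb{Z}^d$, $S_v=\prod_i S_{x_i}^{v_i}$ and $\sigma_v$ is the substitution $\mathbf{x}\mapsto\mathbf{x}+v$ (acting entrywise on vectors/matrices). $f$ is D-finite if $\mathbb{A}'.f$ (equivalently $\mathbb{A}.f$ for $\mathbb{A}=K(\mathbf{x},\mathbf{z})[S_{x_1},\dots,S_{x_d},\theta_{z_1},\dots,\theta_{z_l}]$) is finite-dimensional over $K(\mathbf{x},\mathbf{z})$. A conservative matrix field of dimension $d$, rank $r$ over a field $k$ is a map $\mathcal{M}:\mathbb{Z}^d\to\mathrm{GL}_r(k(\mathbf{x}))$ with $\mathcal{M}_{v+w}=\mathcal{M}_v\sigma_v(\mathcal{M}_w)$ for all $v,w$. *)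

(* Defs.v *)
From HB Require Import structures.
From mathcomp Require Import all_boot all_order all_algebra.
From mathcomp Require Import ring boolp.
From mathcomp Require Import freeg mpoly.

Set Implicit Arguments.
Unset Strict Implicit.
Unset Printing Implicit Defensive.

Import Order.TTheory GRing.Theory.
Local Open Scope ring_scope.

Record mpseries (n : nat) (R : Type) := MPSeries { mps_coef : 'X_{1..n} -> R }.

Notation "{ 'mps' R [ n ] }" := (mpseries n R)
  (at level 0, R at level 2, n at level 2, format "{ 'mps'  R [ n ] }").

HB.instance Definition _ n R := gen_eqMixin {mps R[n]}.
HB.instance Definition _ n R := gen_choiceMixin {mps R[n]}.

Lemma mpsP n R (f g : {mps R[n]}) : mps_coef f =1 mps_coef g -> f = g.
Proof. by case: f g => [f] [g] /= /funext ->. Qed.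

Section MPSeriesRing.
Variables (n : nat) (R : comNzRingType).
Implicit Types f g h : {mps R[n]}.

Definition mps_zero : {mps R[n]} := MPSeries (fun=> 0).
Definition mps_one : {mps R[n]} := MPSeries (fun m => (m == 0%MM)%:R).
Definition mps_opp f : {mps R[n]} := MPSeries (fun m => - mps_coef f m).
Definition mps_add f g : {mps R[n]} :=
  MPSeries (fun m => mps_coef f m + mps_coef g m).
(* The degree bounds only make the index type finite: the range of summation is
   all the pairs of multi-indices with sum m. *)
Definition mps_mul f g : {mps R[n]} := MPSeries (fun m =>
  \sum_(k : 'X_{1..n < (mdeg m).+1, (mdeg m).+1} | m == (k.1 + k.2)%MM)
     mps_coef f k.1 * mps_coef g k.2).

Fact mps_addA : associative mps_add.
Proof. by move=> f g h; apply: mpsP => m /=; rewrite addrA. Qed.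
Fact mps_addC : commutative mps_add.
Proof. by move=> f g; apply: mpsP => m /=; rewrite addrC. Qed.
Fact mps_add0 : left_id mps_zero mps_add.
Proof. by move=> f; apply: mpsP => m /=; rewrite add0r. Qed.
Fact mps_addN : left_inverse mps_zero mps_opp mps_add.
Proof. by move=> f; apply: mpsP => m /=; rewrite addNr. Qed.

HB.instance Definition _ := GRing.isZmodule.Build {mps R[n]}
  mps_addA mps_addC mps_add0 mps_addN.

Let trunc N f : {mpoly R[n]} :=
  \sum_(k : 'X_{1..n < N}) mps_coef f k *: 'X_[k].

Let mcoeff_trunc N f m : (mdeg m < N)%N -> (trunc N f)@_m = mps_coef f m.
Proof.
move=> lt_mN; rewrite raddf_sum /= (bigD1 (BMultinom lt_mN)) //=.
rewrite mcoeffZ mcoeffX eqxx mulr1 big1 ?addr0 // => k ne_k.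
rewrite mcoeffZ mcoeffX; case: eqP => [eq_k|_]; last by rewrite mulr0.
by case/eqP: ne_k; apply/val_inj.
Qed.

Let mps_mulE f g N p q m : (mdeg m < N)%N ->
  (forall k, mdeg k < N -> p@_k = mps_coef f k)%N ->
  (forall k, mdeg k < N -> q@_k = mps_coef g k)%N ->
  mps_coef (mps_mul f g) m = (p * q)@_m.
Proof.
move=> lt_mN Ep Eq; rewrite mcoeffM; apply: eq_bigr => -[k1 k2] _ /=.
by rewrite Ep ?Eq //; apply: leq_trans (bmdeg _) _.
Qed.

Fact mps_mulA : associative mps_mul.
Proof.
move=> f g h; apply: mpsP => m; pose N := (mdeg m).+1.
have T a k : (mdeg k < N)%N -> (trunc N a)@_k = mps_coef a k.
  exact: mcoeff_trunc.
have TM a b k : (mdeg k < N)%N ->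
    (trunc N a * trunc N b)@_k = mps_coef (mps_mul a b) k.
  by move=> ltk; apply/esym/(mps_mulE ltk); apply: T.
rewrite (mps_mulE (ltnSn _) (T f) (TM g h)).
by rewrite (mps_mulE (ltnSn _) (TM f g) (T h)) mulrA.
Qed.

Fact mps_mulC : commutative mps_mul.
Proof.
move=> f g; apply: mpsP => m; have T := @mcoeff_trunc (mdeg m).+1.
by rewrite !(mps_mulE (ltnSn _) (T _) (T _)) mulrC.
Qed.

Fact mps_mul1 : left_id mps_one mps_mul.
Proof.
move=> f; apply: mpsP => m; have T := @mcoeff_trunc (mdeg m).+1.
rewrite (@mps_mulE mps_one f _ 1 _ _ (ltnSn _) _ (T _)) ?mul1r ?T //.
by move=> k _; rewrite mcoeff1.
Qed.

Fact mps_mulDl : left_distributive mps_mul mps_add.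
Proof.
move=> f g h; apply: mpsP => m /=; rewrite -big_split /=.
by apply: eq_bigr => k _; rewrite mulrDl.
Qed.

Fact mps_one_neq0 : mps_one != mps_zero.
Proof.
apply/eqP => /(congr1 (fun f => mps_coef f 0%MM)) /= /eqP.
by rewrite eqxx oner_eq0.
Qed.

HB.instance Definition _ := GRing.Zmodule_isComNzRing.Build {mps R[n]}
  mps_mulA mps_mulC mps_mul1 mps_mulDl mps_one_neq0.

Definition mps_unit : pred {mps R[n]} := fun f => `[< exists g, g * f = 1 >].
Definition mps_inv f : {mps R[n]} :=
  if pselect (exists g, g * f = 1) is left ex_g then projT1 (cid ex_g) else f.

Fact mps_mulV : {in mps_unit, left_inverse 1 mps_inv *%R}.
Proof.
move=> f /asboolP f_unit; rewrite /mps_inv; case: pselect => // ex_g.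
exact: projT2 (cid ex_g).
Qed.
Fact mps_unitP f g : g * f = 1 -> mps_unit f.
Proof. by move=> gf1; apply/asboolP; exists g. Qed.
Fact mps_inv_out : {in [predC mps_unit], mps_inv =1 id}.
Proof.
move=> f /asboolP nf_unit; rewrite /mps_inv.
by case: pselect.
Qed.

HB.instance Definition _ := GRing.ComNzRing_hasMulInverse.Build {mps R[n]}
  mps_mulV mps_unitP mps_inv_out.

End MPSeriesRing.

Section MPSeriesDomain.
Variables (n : nat) (R : idomainType).
Implicit Types f g : {mps R[n]}.

Let mps_valuation f : f != 0 -> exists2 m,
  mps_coef f m != 0 & forall k, (k < m)%O -> mps_coef f k = 0.
Proof.
move=> nz_f; have [m fm] : exists m, mps_coef f m != 0.
  apply: contrapT => f0; case/eqP: nz_f; apply: mpsP => m /=.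
  by apply: contrapT => /eqP fm; apply: f0; exists m.
elim/(@ltmwf n): m fm => m IHm fm.
have [[k lt_km fk]|no_k] := pselect (exists2 k, (k < m)%O & mps_coef f k != 0).
  exact: IHm lt_km fk.
exists m => // k lt_km; apply: contrapT => /eqP fk.
by apply: no_k; exists k.
Qed.

Fact mps_integral f g : f * g = 0 -> (f == 0) || (g == 0).
Proof.
apply: contra_eqT; rewrite negb_or.
case/andP=> /mps_valuation[m fm ltm] /mps_valuation[p gp ltp].
apply/eqP => /(congr1 (fun h => mps_coef h (m + p)%MM)) /=.
have bm : (mdeg m < (mdeg (m + p)).+1)%N by rewrite ltnS mdegD leq_addr.
have bp : (mdeg p < (mdeg (m + p)).+1)%N by rewrite ltnS mdegD leq_addl.
rewrite (bigD1 (BMultinom bm, BMultinom bp)) //= big1 ?addr0.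
  by move/eqP; rewrite mulf_eq0 (negPf fm) (negPf gp).
move=> [k1 k2] /= /andP[/eqP eq_k ne_k].
have [lt1|gt1|eq1] := ltgtP (bmnm k1) m.
- by rewrite ltm ?mul0r.
- rewrite [mps_coef g _]ltp ?mulr0 // ltNge; apply/negP => le2.
  by have := ltmc_le_add gt1 le2; rewrite -eq_k ltxx.
- have eq2 : k2 = p :> 'X_{1..n}.
    by have/esym := eq_k; rewrite eq1 => /addmI.
  by case/eqP: ne_k; congr (_, _); apply/val_inj.
Qed.

HB.instance Definition _ :=
  GRing.ComUnitRing_isIntegral.Build {mps R[n]} mps_integral.

End MPSeriesDomain.

Notation "x %:F" := (@FracField.tofrac _ x) : ring_scope.

(* Meaningful for an injective ring morphism phi, see frac_liftE. *)
Definition frac_lift (R : idomainType) (E : fieldType) (phi : R -> E)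
    (q : {fraction R}) : E :=
  phi \n_(repr q) / phi \d_(repr q).

(* Meaningful for a derivation D, see frac_derivE. *)
Definition frac_deriv (R : idomainType) (D : R -> R) (q : {fraction R}) :
    {fraction R} :=
  let x := \n_(repr q) in let y := \d_(repr q) in
  (D x * y - x * D y)%:F / (y ^+ 2)%:F.

Section FracTheory.
Variables (R : idomainType).
Implicit Types x y : R.

Lemma frac_numden (q : {fraction R}) :
  q = (\n_(repr q))%:F / (\d_(repr q))%:F.
Proof.
have nz_d := denom_ratioP (repr q).
apply: (canRL (mulfK _)); first by rewrite tofrac_eq0.
rewrite -{1}[q]reprK; move: (repr q) nz_d => u nz_d.
unlock FracField.tofrac; rewrite -[LHS]FracField.pi_mul /FracField.mulf.
apply/eqmodP; rewrite /= FracField.equivfE.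
by rewrite !numden_Ratio ?(oner_eq0, mulf_neq0) // !mulr1 mulrC.
Qed.

Lemma frac_numdenE x y : y != 0 ->
  x * \d_(repr (x%:F / y%:F)) = \n_(repr (x%:F / y%:F)) * y.
Proof.
move=> nz_y; apply/eqP; rewrite -tofrac_eq !tofracM.
set q := _ / _; have nz_d : (\d_(repr q))%:F != 0.
  by rewrite tofrac_eq0 denom_ratioP.
have nz_yF : y%:F != 0 by rewrite tofrac_eq0.
by rewrite -(eqr_div _ _ nz_yF nz_d) -frac_numden.
Qed.

Lemma frac_liftE (E : fieldType) (phi : {rmorphism R -> E}) x y :
  injective phi -> y != 0 -> frac_lift phi (x%:F / y%:F) = phi x / phi y.
Proof.
move=> phi_inj nz_y; have nz_phi z : z != 0 -> phi z != 0.
  by rewrite -(inj_eq phi_inj) rmorph0.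
apply/eqP; rewrite eqr_div ?nz_phi ?denom_ratioP //.
by rewrite -!rmorphM frac_numdenE.
Qed.

Lemma frac_derivE (D : R -> R) x y :
  (forall u v, D (u * v) = D u * v + u * D v) -> y != 0 ->
  frac_deriv D (x%:F / y%:F) = (D x * y - x * D y)%:F / (y ^+ 2)%:F.
Proof.
move=> DM nz_y; apply/eqP; rewrite /frac_deriv /=.
rewrite eqr_div ?tofrac_eq0 ?expf_neq0 ?denom_ratioP // -!tofracM tofrac_eq.
have := frac_numdenE x nz_y; set n := \n_ _; set e := \d_ _ => eq_xe.
have := congr1 D eq_xe; rewrite !DM => /esym/(canRL (addrK _)) eqDn.
have -> : (D n * e - n * D e) * y ^+ 2
          = (D n * y) * e * y - (n * y) * D e * y by ring.
rewrite eqDn -eq_xe; apply/eqP.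
have -> : (D x * e + x * D e - n * D y) * e * y - x * e * D e * y
          = D x * y * e ^+ 2 - (n * y) * D y * e by ring.
by rewrite -eq_xe; ring.
Qed.

End FracTheory.

Notation ratfun k n := {fraction {mpoly k[n]}}.

Definition shift_mpoly (k : fieldType) (n : nat) (v : 'rV[int]_n)
    (p : {mpoly k[n]}) : {mpoly k[n]} :=
  p \mPo [tuple 'X_i + ((v 0 i)%:~R)%:MP | i < n].

Definition shift_ratfun (k : fieldType) (n : nat) (v : 'rV[int]_n) :
    ratfun k n -> ratfun k n :=
  frac_lift (fun p => (shift_mpoly v p)%:F).

Definition conservative_matrix_field (k : fieldType) (d r : nat)
    (M : 'rV[int]_d -> 'M[ratfun k d]_r) : Prop :=
  (forall v, M v \in unitmx) /\
  (forall v w, M (v + w) = M v *m map_mx (shift_ratfun v) (M w)).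

(* D_1^(a_1) (D_2^(a_2) (... x)) for a family of commuting operators D_j. *)
Definition iter_mnm (l : nat) (T : Type) (D : 'I_l -> T -> T)
    (a : 'X_{1..l}) (x : T) : T :=
  foldr (fun j => iter (a j) (D j)) x (enum 'I_l).

Section OreAlgebra.
Variables (K : fieldType) (d l : nat).

Notation Kx := (ratfun K d).
Notation Kz := (ratfun K l).
(* K(x, z) is presented as K(z)(x), the field of rational functions in x over
   K(z), so that matrices over it are literally those of a matrix field over
   K(z). *)
Notation Kxz := (ratfun Kz d).

Notation F := {mps Kx[l]}.
(* K(x, z) does not act on F, where z_j is not invertible, but on Frac F. *)
Notation fracF := {fraction F}.

Definition theta_Kz (j : 'I_l) : Kz -> Kz :=
  frac_deriv (fun p : {mpoly K[l]} => 'X_j * p^`M(j)).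

Definition theta_Kxz (j : 'I_l) : Kxz -> Kxz :=
  frac_deriv (fun p : {mpoly Kz[d]} => map_mpoly (theta_Kz j) p).

Definition shift_mps (v : 'rV[int]_d) (f : F) : F :=
  MPSeries (fun m => shift_ratfun v (mps_coef f m)).

Definition theta_mps (j : 'I_l) (f : F) : F :=
  MPSeries (fun m => mps_coef f m *+ m j).

Definition shift_fracF (v : 'rV[int]_d) : fracF -> fracF :=
  frac_lift (fun f => (shift_mps v f)%:F).

Definition theta_fracF (j : 'I_l) : fracF -> fracF :=
  frac_deriv (theta_mps j).

Definition mps_of_mpoly (p : {mpoly K[l]}) : F :=
  MPSeries (fun m => ((p@_m)%:MP)%:F).

Definition emb_Kz : Kz -> fracF := frac_lift (fun p => (mps_of_mpoly p)%:F).

Definition mps_const (c : Kx) : F :=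
  MPSeries (fun m => if m == 0%MM then c else 0).

(* The K-algebra embedding with x_i |-> x_i and z_j |-> z_j. *)
Definition emb_Kxz : Kxz -> fracF :=
  frac_lift (mmap emb_Kz (fun i => (mps_const ('X_i)%:F)%:F)).

(* Elements are written in the basis of the S_u theta^a, with coefficients on the
   left: << c *g (u, a) >> is c S_u theta^a. *)
Definition ore := {freeg ('rV[int]_d * 'X_{1..l}) / Kxz}.

Definition ore_S (v : 'rV[int]_d) : ore := << (v, 0%MM) >>.

(* S_v (c S_u theta^a) = sigma_v(c) S_(v + u) theta^a *)
Definition ore_lmulS (v : 'rV[int]_d) (L : ore) : ore :=
  \sum_(k <- dom L) << shift_ratfun v (coeff k L) *g (v + k.1, k.2) >>.

(* theta_j (c S_u theta^a) = c S_u theta^(a + e_j) + theta_j(c) S_u theta^a *)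
Definition ore_lmultheta (j : 'I_l) (L : ore) : ore :=
  \sum_(k <- dom L) (<< coeff k L *g (k.1, (k.2 + U_(j))%MM) >>
                     + << theta_Kxz j (coeff k L) *g k >>).

Definition ore_mul (L N : ore) : ore :=
  \sum_(k <- dom L)
     (coeff k L *: ore_lmulS k.1 (iter_mnm ore_lmultheta k.2 N)).

Definition ore_act (L : ore) (g : fracF) : fracF :=
  \sum_(k <- dom L)
     emb_Kxz (coeff k L) * shift_fracF k.1 (iter_mnm theta_fracF k.2 g).

Definition ore_orbit (f : F) (g : fracF) : Prop :=
  exists L : ore, g = ore_act L f%:F.

Definition spans (V : fracF -> Prop) (n : nat) (B : 'I_n -> fracF) : Prop :=
  (forall i, V (B i)) /\
  (forall g, V g -> exists c : 'I_n -> Kxz, g = \sum_i emb_Kxz (c i) * B i).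

Definition lin_indep (n : nat) (B : 'I_n -> fracF) : Prop :=
  forall c : 'I_n -> Kxz,
    \sum_i emb_Kxz (c i) * B i = 0 -> forall i, c i = 0.

Definition is_basis (V : fracF -> Prop) (n : nat) (B : 'I_n -> fracF) : Prop :=
  spans V B /\ lin_indep B.

Definition has_dim (V : fracF -> Prop) (n : nat) : Prop :=
  exists B : 'I_n -> fracF, is_basis V B.

Definition D_finite (f : F) : Prop :=
  exists n (B : 'I_n -> fracF), spans (ore_orbit f) B.

End OreAlgebra.

(* Main.v *)
(** Each shift is an automorphism of Frac(F), semilinear over K(x, z) and
    additive in v, and S_v acts on the orbit of f by it. Applying sigma_v to
    B M_w = sigma_w(B) therefore gives
    sigma_(v + w)(B) = sigma_v(B) sigma_v(M_w) = B M_v sigma_v(M_w), and freeness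
    of B yields the cocycle identity; the case w = - v makes M_v invertible.
    The remaining point is that K(x, z) does embed in Frac(F), i.e., that the x_i
    are algebraically independent over K(z) in K(x)[[z]]. *)
Require Import Defs.
From HB Require Import structures.
From mathcomp Require Import all_boot all_order all_algebra.
From mathcomp Require Import freeg mpoly.

Set Implicit Arguments.
Unset Strict Implicit.
Unset Printing Implicit Defensive.

Import GRing.Theory.
Local Open Scope ring_scope.

(** * Extending injective morphisms to fraction fields *)

Section FracLift.
Variables (R : idomainType) (E : fieldType) (phi : {rmorphism R -> E}).
Hypothesis phi_inj : injective phi.

Lemma tofrac_inj : injective (@FracField.tofrac R).
Proof. by move=> x y /eqP; rewrite tofrac_eq => /eqP. Qed.

Lemma fracP (q : {fraction R}) : exists x y, y != 0 /\ q = x%:F / y%:F.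
Proof.
by exists \n_(repr q), \d_(repr q); rewrite denom_ratioP -frac_numden.
Qed.

Lemma frac_lift_tofrac x : frac_lift phi x%:F = phi x.
Proof.
by rewrite -[x%:F]divr1 -tofrac1 frac_liftE ?oner_eq0 // rmorph1 divr1.
Qed.

Let phi_neq0 y : y != 0 -> phi y != 0.
Proof. by rewrite -(inj_eq phi_inj) rmorph0. Qed.

(** Injectivity of [phi] keeps denominators nonzero, so [frac_liftE] evaluates the lift on any
    chosen representative, in particular on the one over the product of the two denominators. *)
Lemma frac_lift_is_zmod_morphism : zmod_morphism (frac_lift phi).
Proof.
move=> p q; have [x [y [y0 ->]]] := fracP p; have [u [v [v0 ->]]] := fracP q.
rewrite -mulNr addf_div ?tofrac_eq0 // -tofracN -!tofracM -tofracD.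
rewrite !frac_liftE ?mulf_neq0 // -mulNr addf_div ?phi_neq0 //.
by rewrite !(rmorphM, rmorphD, rmorphN).
Qed.

Lemma frac_lift_is_monoid_morphism : monoid_morphism (frac_lift phi).
Proof.
split=> [|p q]; first by rewrite -tofrac1 frac_lift_tofrac rmorph1.
have [x [y [y0 ->]]] := fracP p; have [u [v [v0 ->]]] := fracP q.
rewrite mulf_div -!tofracM !frac_liftE ?mulf_neq0 //.
by rewrite mulf_div !rmorphM.
Qed.

End FracLift.

(** Field morphisms respect quotients. Together with [eq_mpoly_rmorph], this reduces the identities
    between shifts and embeddings to constants and variables. *)
Lemma eq_frac_rmorph (R : idomainType) (E : fieldType)
    (g h : {rmorphism {fraction R} -> E}) :
  (forall x, g x%:F = h x%:F) -> g =1 h.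
Proof.
by move=> gh q; have [x [y [_ ->]]] := fracP q; rewrite !fmorph_div !gh.
Qed.

Lemma eq_mpoly_rmorph (R : comNzRingType) (E : comNzRingType) (n : nat)
    (g h : {rmorphism {mpoly R[n]} -> E}) :
  (forall c, g c%:MP = h c%:MP) -> (forall i, g 'X_i = h 'X_i) -> g =1 h.
Proof.
move=> ghC ghX p; rewrite [p]mpolyE !rmorph_sum; apply: eq_bigr => m _.
rewrite -mul_mpolyC !rmorphM ghC mpolyXE_id !rmorph_prod; congr (_ * _).
by apply: eq_bigr => i _; rewrite !rmorphXn ghX.
Qed.

Lemma frac_mpoly_clear_denom (R : idomainType) (n : nat)
    (p : {mpoly {fraction R}[n]}) :
  exists (D : R) (q : {mpoly R[n]}),
    D != 0 /\ D%:F *: p = map_mpoly (@FracField.tofrac R) q.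
Proof.
elim/mpolyind: p => [|c m p _ _ [D [q [D0 Dp]]]].
  by exists 1, 0; rewrite oner_eq0 scaler0 raddf0.
have [x [y [y0 ->]]] := fracP c.
(* [D] clears the denominators of the tail and [y] that of the new coefficient [x / y], so their
   product clears both. *)
exists (D * y), ((D * x) *: 'X_[m] + y *: q); split; first exact: mulf_neq0.
have Dc : (D * y)%:F * (x%:F / y%:F) = (D * x)%:F.
  by rewrite !tofracM mulrACA divff ?mulr1 // tofrac_eq0.
rewrite [RHS]raddfD /= !map_mpolyZ map_mpolyX -Dp scalerDr !scalerA Dc.
by rewrite -tofracM [y * D]mulrC.
Qed.

(** * The shift automorphisms of polynomials and rational functions *)

Section Shift.
Variables (k : fieldType) (n : nat).
Implicit Types v w : 'rV[int]_n.

HB.instance Definition _ v :=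
  GRing.RMorphism.copy (@shift_mpoly k n v)
    (comp_mpoly [tuple 'X_i + ((v 0 i)%:~R)%:MP | i < n]).

Lemma shift_mpolyC v c : shift_mpoly v c%:MP = c%:MP :> {mpoly k[n]}.
Proof. exact: comp_mpolyC. Qed.

Lemma shift_mpolyX v i :
  shift_mpoly v 'X_i = 'X_i + ((v 0 i)%:~R)%:MP :> {mpoly k[n]}.
Proof. by rewrite /shift_mpoly comp_mpolyXU -tnth_nth tnth_mktuple. Qed.

Lemma shift_mpolyD v w (p : {mpoly k[n]}) :
  shift_mpoly (v + w) p = shift_mpoly v (shift_mpoly w p).
Proof.
apply: (eq_mpoly_rmorph (g := shift_mpoly (v + w))
  (h := shift_mpoly v \o shift_mpoly w)) => [c|i] /=; rewrite ?shift_mpolyC //.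
rewrite !shift_mpolyX rmorphD /= shift_mpolyX shift_mpolyC mxE -addrA.
by rewrite -mpolyCD -rmorphD.
Qed.

Lemma shift_mpoly0 (p : {mpoly k[n]}) : shift_mpoly 0 p = p.
Proof.
apply: (eq_mpoly_rmorph (g := shift_mpoly 0) (h := idfun)) => [c|i] /=.
  exact: shift_mpolyC.
by rewrite shift_mpolyX mxE mpolyC0 addr0.
Qed.

(** The shift by [- v] is a left inverse. Injectivity is what allows the shift to be lifted to
    fractions. *)
Lemma shift_mpoly_inj v : injective (@shift_mpoly k n v).
Proof.
by apply: (@can_inj _ _ _ (shift_mpoly (- v))) => p;
  rewrite -shift_mpolyD addNr shift_mpoly0.
Qed.

(** The map lifted in [shift_ratfun], packaged as a morphism so that the results on [frac_lift]
    apply to it up to conversion. *)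
Let shift_tofrac v : {rmorphism {mpoly k[n]} -> ratfun k n} :=
  @FracField.tofrac _ \o shift_mpoly v.

Let shift_tofrac_inj v : injective (shift_tofrac v).
Proof. exact: inj_comp (@tofrac_inj _) (@shift_mpoly_inj v). Qed.

HB.instance Definition _ v := GRing.isZmodMorphism.Build _ _ (shift_ratfun v)
  (frac_lift_is_zmod_morphism (@shift_tofrac_inj v)).
HB.instance Definition _ v := GRing.isMonoidMorphism.Build _ _ (shift_ratfun v)
  (frac_lift_is_monoid_morphism (@shift_tofrac_inj v)).

Lemma shift_ratfun_tofrac v (p : {mpoly k[n]}) :
  shift_ratfun v p%:F = (shift_mpoly v p)%:F.
Proof. exact: (frac_lift_tofrac (@shift_tofrac_inj v)). Qed.

Lemma shift_ratfunD v w (q : ratfun k n) :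
  shift_ratfun (v + w) q = shift_ratfun v (shift_ratfun w q).
Proof.
apply: (eq_frac_rmorph (g := shift_ratfun (v + w))
  (h := shift_ratfun v \o shift_ratfun w)) => p /=.
by rewrite !shift_ratfun_tofrac shift_mpolyD.
Qed.

Lemma shift_ratfun0 (q : ratfun k n) : shift_ratfun 0 q = q.
Proof.
apply: (eq_frac_rmorph (g := shift_ratfun 0) (h := idfun)) => p /=.
by rewrite shift_ratfun_tofrac shift_mpoly0.
Qed.

End Shift.

(** * The shift on power series and on their fractions *)

Section Embedding.
Variables (K : fieldType) (d l : nat).
Implicit Types v w : 'rV[int]_d.

Notation Kx := (ratfun K d).
Notation Kz := (ratfun K l).
Notation Kxz := (ratfun Kz d).
Notation F := {mps Kx[l]}.
Notation fracF := {fraction F}.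

Fact shift_mps_is_zmod_morphism v : zmod_morphism (@shift_mps K d l v).
Proof. by move=> f g; apply: mpsP => m; apply: rmorphB. Qed.

Fact shift_mps_is_monoid_morphism v : monoid_morphism (@shift_mps K d l v).
Proof.
split=> [|f g]; apply: mpsP => m /=; first exact: rmorph_nat.
by rewrite rmorph_sum; apply: eq_bigr => a _; apply: rmorphM.
Qed.

HB.instance Definition _ v :=
  GRing.isZmodMorphism.Build _ _ (@shift_mps K d l v)
  (shift_mps_is_zmod_morphism v).
HB.instance Definition _ v :=
  GRing.isMonoidMorphism.Build _ _ (@shift_mps K d l v)
  (shift_mps_is_monoid_morphism v).

Lemma shift_mpsD v w (f : F) : shift_mps (v + w) f = shift_mps v (shift_mps w f).
Proof. by apply: mpsP => m; apply: shift_ratfunD. Qed.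

Lemma shift_mps0 (f : F) : shift_mps 0 f = f.
Proof. by apply: mpsP => m; apply: shift_ratfun0. Qed.

Lemma shift_mps_inj v : injective (@shift_mps K d l v).
Proof.
by apply: (@can_inj _ _ _ (shift_mps (- v))) => f;
  rewrite -shift_mpsD addNr shift_mps0.
Qed.

Let shift_mps_tofrac v : {rmorphism F -> fracF} :=
  @FracField.tofrac _ \o @shift_mps K d l v.

Let shift_mps_tofrac_inj v : injective (shift_mps_tofrac v).
Proof. exact: inj_comp (@tofrac_inj _) (@shift_mps_inj v). Qed.

HB.instance Definition _ v :=
  GRing.isZmodMorphism.Build _ _ (@shift_fracF K d l v)
  (frac_lift_is_zmod_morphism (@shift_mps_tofrac_inj v)).
HB.instance Definition _ v :=
  GRing.isMonoidMorphism.Build _ _ (@shift_fracF K d l v)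
  (frac_lift_is_monoid_morphism (@shift_mps_tofrac_inj v)).

Lemma shift_fracF_tofrac v (f : F) : shift_fracF v f%:F = (shift_mps v f)%:F.
Proof. exact: (frac_lift_tofrac (@shift_mps_tofrac_inj v)). Qed.

Lemma shift_fracFD v w (q : fracF) :
  shift_fracF (v + w) q = shift_fracF v (shift_fracF w q).
Proof.
apply: (eq_frac_rmorph (g := @shift_fracF K d l (v + w))
  (h := @shift_fracF K d l v \o @shift_fracF K d l w)) => f /=.
by rewrite !shift_fracF_tofrac shift_mpsD.
Qed.

Lemma shift_fracF0 (q : fracF) : shift_fracF 0 q = q.
Proof.
apply: (eq_frac_rmorph (g := @shift_fracF K d l 0) (h := idfun)) => f /=.
by rewrite shift_fracF_tofrac shift_mps0.
Qed.

(** * The embedding of K(x, z) into Frac(F), and its compatibility with shifts *)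

Notation mps_of_mpoly := (@mps_of_mpoly K d l).
Notation mps_const := (@mps_const K d l).
Notation emb_Kz := (@emb_Kz K d l).
Notation emb_Kxz := (@emb_Kxz K d l).

Fact mps_of_mpoly_is_zmod_morphism : zmod_morphism mps_of_mpoly.
Proof.
by move=> p q; apply: mpsP => m /=; rewrite mcoeffB mpolyCB tofracB.
Qed.

Fact mps_of_mpoly_is_monoid_morphism : monoid_morphism mps_of_mpoly.
Proof.
split=> [|p q]; apply: mpsP => m /=; first by rewrite mcoeff1 !rmorph_nat.
by rewrite mcoeffM !rmorph_sum; apply: eq_bigr => a _; rewrite /= !rmorphM.
Qed.

HB.instance Definition _ := GRing.isZmodMorphism.Build _ _ mps_of_mpoly
  mps_of_mpoly_is_zmod_morphism.
HB.instance Definition _ := GRing.isMonoidMorphism.Build _ _ mps_of_mpoly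
  mps_of_mpoly_is_monoid_morphism.

Lemma mps_of_mpoly_inj : injective mps_of_mpoly.
Proof.
move=> p q pq; apply/mpolyP => m.
have /tofrac_inj/eqP := congr1 (fun f => mps_coef f m) pq.
by rewrite mpolyC_eq => /eqP.
Qed.

Let mps_of_mpoly_tofrac : {rmorphism {mpoly K[l]} -> fracF} :=
  @FracField.tofrac _ \o mps_of_mpoly.

Let mps_of_mpoly_tofrac_inj : injective mps_of_mpoly_tofrac.
Proof. exact: inj_comp (@tofrac_inj _) mps_of_mpoly_inj. Qed.

HB.instance Definition _ := GRing.isZmodMorphism.Build _ _ emb_Kz
  (frac_lift_is_zmod_morphism mps_of_mpoly_tofrac_inj).
HB.instance Definition _ := GRing.isMonoidMorphism.Build _ _ emb_Kz
  (frac_lift_is_monoid_morphism mps_of_mpoly_tofrac_inj).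

Lemma emb_Kz_tofrac p : emb_Kz p%:F = (mps_of_mpoly p)%:F.
Proof. exact: (frac_lift_tofrac mps_of_mpoly_tofrac_inj). Qed.

(** In the convolution sum only the pair [(m, 0)] survives, a constant series having no other
    nonzero coefficient. *)
Lemma mps_coefMC (f : F) c m : mps_coef (f * mps_const c) m = mps_coef f m * c.
Proof.
have bm : (mdeg m < (mdeg m).+1)%N by [].
have b0 : (mdeg (0%MM : 'X_{1..l}) < (mdeg m).+1)%N by rewrite mdeg0.
rewrite /= (bigD1 (BMultinom bm, BMultinom b0)) /= ?addm0 //.
rewrite eqxx big1 ?addr0 // => -[k1 k2] /= /andP[/eqP eq_k ne_k].
case: eqP => [k20|_]; last by rewrite mulr0.
case/eqP: ne_k; congr (_, _); apply/val_inj => //=.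
by apply/esym; rewrite [LHS]eq_k k20 addm0.
Qed.

Fact mps_const_is_zmod_morphism : zmod_morphism mps_const.
Proof. by move=> a b; apply: mpsP => m /=; case: eqP; rewrite ?subr0. Qed.

Fact mps_const_is_monoid_morphism : monoid_morphism mps_const.
Proof.
split=> [|a b]; apply: mpsP => m; first by rewrite /=; case: eqP.
by rewrite mps_coefMC /=; case: eqP => // _; rewrite mul0r.
Qed.

HB.instance Definition _ := GRing.isZmodMorphism.Build _ _ mps_const
  mps_const_is_zmod_morphism.
HB.instance Definition _ := GRing.isMonoidMorphism.Build _ _ mps_const
  mps_const_is_monoid_morphism.

(** The restriction of [emb_Kxz] to K(z)[x], named so that it can carry a morphism structure. *)
Definition emb_poly : {mpoly Kz[d]} -> fracF :=
  mmap emb_Kz (fun i => (mps_const ('X_i)%:F)%:F).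

HB.instance Definition _ := GRing.RMorphism.on emb_poly.

Lemma emb_polyC c : emb_poly c%:MP = emb_Kz c.
Proof. exact: mmapC. Qed.

Lemma emb_polyX i : emb_poly 'X_i = (mps_const ('X_i)%:F)%:F.
Proof. by rewrite /emb_poly mmapX mmap1U. Qed.

(** With coefficients in K[z] no division occurs, so the image lies in F itself, where coefficients
    can be compared. *)
Lemma emb_poly_map_tofrac (q : {mpoly {mpoly K[l]}[d]}) :
  emb_poly (map_mpoly (@FracField.tofrac _) q)
  = (mmap mps_of_mpoly (fun i => mps_const ('X_i)%:F) q)%:F.
Proof.
apply: (eq_mpoly_rmorph (g := emb_poly \o map_mpoly (@FracField.tofrac _))
  (h := @FracField.tofrac _ \o mmap mps_of_mpoly (fun i => mps_const ('X_i)%:F)))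
  => [c|i] /=.
  by rewrite map_mpolyC emb_polyC emb_Kz_tofrac mmapC.
by rewrite map_mpolyX emb_polyX mmapX mmap1U.
Qed.

(** This exchanges the two sets of variables: K[z][x] is read as series in z with coefficients in
    K[x]. By additivity it suffices to treat a single monomial c x^m, whose image is the series of c
    times a constant series. *)
Lemma mps_coef_mmap (q : {mpoly {mpoly K[l]}[d]}) a :
  mps_coef (mmap mps_of_mpoly (fun i => mps_const ('X_i)%:F) q) a
  = (map_mpoly (mcoeff a) q)%:F.
Proof.
elim/mpolyind: q => [|c m q _ _ IHq]; first by rewrite !raddf0.
rewrite !raddfD /= -IHq; congr (_ + _).
rewrite mmapZ mmapX.
have -> : mmap1 (fun i => mps_const ('X_i)%:F) m = mps_const ('X_[m])%:F.
  rewrite mpolyXE_id !rmorph_prod; apply: eq_bigr => i _.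
  by rewrite !rmorphXn.
rewrite mps_coefMC /= -tofracM mul_mpolyC; congr (_%:F).
apply/mpolyP => u; rewrite mcoeff_map_mpoly !mcoeffZ !mcoeffX.
by case: eqP => _; rewrite ?(mulr1, mulr0) ?raddf0.
Qed.

(* Once denominators are cleared, the coefficient of the image at z^a is the
   polynomial in x whose coefficients are those of the argument at z^a. *)
Lemma emb_poly_inj : injective emb_poly.
Proof.
apply: raddf_inj => p p0; have [D [q [D0 Dp]]] := frac_mpoly_clear_denom p.
have q0 : mmap mps_of_mpoly (fun i => mps_const ('X_i)%:F) q = 0.
  apply: tofrac_inj; rewrite -emb_poly_map_tofrac -Dp -mul_mpolyC rmorphM /=.
  by rewrite p0 mulr0 tofrac0.
suff eq_q0 : q = 0.
  move/eqP: Dp; rewrite eq_q0 raddf0 scaler_eq0 tofrac_eq0 (negPf D0) /=.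
  by move/eqP.
apply/mpolyP => m; rewrite mcoeff0; apply/mpolyP => a; rewrite mcoeff0.
have := mps_coef_mmap q a; rewrite q0 -[LHS]tofrac0 => /tofrac_inj.
by move/(congr1 (mcoeff m)); rewrite mcoeff_map_mpoly mcoeff0.
Qed.

HB.instance Definition _ := GRing.isZmodMorphism.Build _ _ emb_Kxz
  (frac_lift_is_zmod_morphism emb_poly_inj).
HB.instance Definition _ := GRing.isMonoidMorphism.Build _ _ emb_Kxz
  (frac_lift_is_monoid_morphism emb_poly_inj).

Lemma emb_Kxz_tofrac p : emb_Kxz p%:F = emb_poly p.
Proof. exact: (frac_lift_tofrac emb_poly_inj). Qed.

(** The series of a polynomial in z has its coefficients in K, where every shift is the identity. *)
Lemma shift_emb_Kz v (c : Kz) : shift_fracF v (emb_Kz c) = emb_Kz c.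
Proof.
apply: (eq_frac_rmorph (g := @shift_fracF K d l v \o emb_Kz)
  (h := emb_Kz)) => p /=.
rewrite emb_Kz_tofrac shift_fracF_tofrac; congr (_%:F); apply: mpsP => m /=.
by rewrite shift_ratfun_tofrac shift_mpolyC.
Qed.

(** Both sides are morphisms in [c]: they agree on K(z), which is fixed, and on each x_i, which goes
    to x_i + v_i. *)
Lemma shift_emb_Kxz v (c : Kxz) :
  shift_fracF v (emb_Kxz c) = emb_Kxz (shift_ratfun v c).
Proof.
apply: (eq_frac_rmorph (g := @shift_fracF K d l v \o emb_Kxz)
  (h := emb_Kxz \o shift_ratfun v)) => p /=.
rewrite shift_ratfun_tofrac !emb_Kxz_tofrac.
apply: (eq_mpoly_rmorph (g := @shift_fracF K d l v \o emb_poly)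
  (h := emb_poly \o shift_mpoly v)) => [a|i] /=.
  by rewrite shift_mpolyC emb_polyC shift_emb_Kz.
rewrite shift_mpolyX rmorphD /= emb_polyX emb_polyC rmorph_int.
rewrite shift_fracF_tofrac.
have -> : shift_mps v (mps_const ('X_i)%:F)
          = mps_const (shift_ratfun v ('X_i)%:F).
  by apply: mpsP => m /=; case: eqP => // _; rewrite rmorph0.
rewrite shift_ratfun_tofrac shift_mpolyX !rmorphD /=; congr (_ + _).
by rewrite !rmorph_int.
Qed.

(** * The action of the Ore algebra on Frac(F) *)

(** Indices outside the support contribute zero. Actions of elements with different supports can
    thus be compared over a common list. *)
Lemma ore_act_subset (L : ore K d l) (g : fracF) s :
  uniq s -> {subset dom L <= s} ->
  ore_act L g = \sum_(k <- s) emb_Kxz (coeff k L)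
                  * shift_fracF k.1 (iter_mnm (@theta_fracF K d l) k.2 g).
Proof.
move=> s_uniq sub_s; rewrite (bigID (mem (dom L))) /= [X in _ + X]big1 => [|k].
  rewrite addr0 -big_filter; apply: perm_big.
  apply: uniq_perm; rewrite ?uniq_dom ?filter_uniq // => k.
  by rewrite mem_filter; case kL: (k \in dom L); rewrite //= sub_s.
by move/coeff_outdom => ->; rewrite rmorph0 mul0r.
Qed.

Lemma ore_actD (L N : ore K d l) (g : fracF) :
  ore_act (L + N) g = ore_act L g + ore_act N g.
Proof.
(* Listing [dom (L + N)] as well makes all three inclusions immediate, whatever cancels in the
   sum. *)
pose s := undup (dom L ++ dom N ++ dom (L + N)).
have in_s (T : ore K d l) : T \in [:: L; N; L + N] -> {subset dom T <= s}.
  by rewrite !inE => /or3P[]/eqP-> k kT; rewrite mem_undup !mem_cat kT ?orbT //.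
rewrite !(ore_act_subset _ (undup_uniq _) (in_s _ _)) ?inE ?eqxx ?orbT //.
by rewrite -big_split; apply: eq_bigr => k _; rewrite coeffD rmorphD mulrDl.
Qed.

Lemma ore_act0 (g : fracF) : ore_act (0 : ore K d l) g = 0.
Proof. by rewrite /ore_act dom0 big_nil. Qed.

Lemma ore_actU c k (g : fracF) : ore_act (<< c *g k >> : ore K d l) g =
  emb_Kxz c * shift_fracF k.1 (iter_mnm (@theta_fracF K d l) k.2 g).
Proof.
rewrite (@ore_act_subset _ _ [:: k]) ?big_seq1 ?coeffU ?eqxx ?mulr1 //.
move=> j; rewrite mem_dom coeffU mem_seq1 [j == k]eq_sym.
by case: (k == j) => //; rewrite mulr0 eqxx.
Qed.

(** Term by term, S_v passes the coefficient by [shift_emb_Kxz] and merges with S_u by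
    [shift_fracFD]. *)
Lemma ore_act_lmulS v (L : ore K d l) (g : fracF) :
  ore_act (ore_lmulS v L) g = shift_fracF v (ore_act L g).
Proof.
rewrite /ore_lmulS (big_morph (fun L => ore_act L g) (fun L N => ore_actD L N g)
  (ore_act0 g)) [in RHS]/ore_act rmorph_sum; apply: eq_bigr => k _.
by rewrite ore_actU shift_fracFD [RHS]rmorphM /= shift_emb_Kxz.
Qed.

Lemma iter_mnm0 T (D : 'I_l -> T -> T) x : iter_mnm D 0%MM x = x.
Proof. by rewrite /iter_mnm; elim: (enum _) => //= j s ->; rewrite mnm0E. Qed.

Lemma ore_act_mulS v (L : ore K d l) (g : fracF) :
  ore_act (ore_mul (ore_S K l v) L) g = shift_fracF v (ore_act L g).
Proof.
(* [ore_S] has a single term, with coefficient 1 and no Euler derivative, so the product reduces to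
   [ore_lmulS]. *)
rewrite /ore_mul domU1 big_seq1 coeffU eqxx mulr1 scale1r iter_mnm0.
exact: ore_act_lmulS.
Qed.

End Embedding.

(** * Cocycles from a semilinear action on a free row, abstractly *)

Section SemilinearCocycle.
Variables (V : zmodType) (E G : fieldType) (emb : {rmorphism E -> G}).
Variables (s : V -> {rmorphism E -> E}) (S : V -> {rmorphism G -> G}).
Hypothesis S0 : forall g, S 0 g = g.
Hypothesis SD : forall v w g, S (v + w) g = S v (S w g).
Hypothesis S_emb : forall v c, S v (emb c) = emb (s v c).
Variables (r : nat) (B : 'rV[G]_r).
Hypothesis B_free : forall c : 'I_r -> E,
  \sum_i emb (c i) * B 0 i = 0 -> forall i, c i = 0.
Implicit Types M N : 'M[E]_r.

(** Each column of [M - N] is a linear relation between the entries of [B]. *)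
Lemma free_row_mulmx_inj M N :
  B *m map_mx emb M = B *m map_mx emb N -> M = N.
Proof.
move=> eqMN; apply/matrixP => i j; apply/eqP; rewrite -subr_eq0; apply/eqP.
apply: (B_free (c := fun i => M i j - N i j)) i.
transitivity ((B *m map_mx emb M) 0 j - (B *m map_mx emb N) 0 j).
  rewrite !mxE -sumrB; apply: eq_bigr => i _.
  by rewrite !mxE rmorphB mulrBl ![_ * B 0 i]mulrC.
by rewrite eqMN subrr.
Qed.

Lemma semilinear_cocycle v w M N :
  B *m map_mx emb M = map_mx (S v) B -> B *m map_mx emb N = map_mx (S w) B ->
  B *m map_mx emb (M *m map_mx (s v) N) = map_mx (S (v + w)) B.
Proof.
move=> M_eq N_eq; rewrite map_mxM mulmxA M_eq.
(* Semilinearity in matrix form. *)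
have -> : map_mx emb (map_mx (s v) N) = map_mx (S v) (map_mx emb N).
  by apply/matrixP => i j; rewrite !mxE S_emb.
by rewrite -map_mxM N_eq; apply/rowP => i; rewrite !mxE SD.
Qed.

Lemma semilinear_cocycle_unit v M N :
  B *m map_mx emb M = map_mx (S v) B -> B *m map_mx emb N = map_mx (S (- v)) B ->
  M \in unitmx.
Proof.
(* For square matrices a right inverse suffices; the cocycle at [v + (- v) = 0] provides one, since
   [S 0] fixes [B]. *)
move=> M_eq N_eq; suff /mulmx1_unit[] : M *m map_mx (s v) N = 1%:M by [].
apply: free_row_mulmx_inj; rewrite (semilinear_cocycle M_eq N_eq).
by rewrite subrr map_mx1 mulmx1; apply/rowP => i; rewrite mxE S0.
Qed.

End SemilinearCocycle.

(** The middle clause gives existence and uniqueness of the matrices, so the last clause, stated for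
    any [M] satisfying the defining equations, is not vacuous and concerns a single family. *)
Theorem theorem3p3 (K : fieldType) (charK : [pchar K] =i pred0) (d l : nat)
    (f : {mps (ratfun K d)[l]}) (r : nat)
    (f_Dfinite : D_finite f)
    (r_dim : has_dim (ore_orbit f) r)
    (b : 'I_r -> ore K d l)
    (B_basis : is_basis (ore_orbit f) (fun i => ore_act (b i) f%:F)) :
  let B := \row_i ore_act (b i) f%:F in
  let SB (v : 'rV[int]_d) := \row_i ore_act (ore_mul (ore_S K l v) (b i)) f%:F in
  [/\ forall v, SB v = map_mx (@shift_fracF K d l v) B,
      forall v, exists! M : 'M[ratfun (ratfun K l) d]_r,
        M \in unitmx /\ B *m map_mx (@emb_Kxz K d l) M = SB v
    & forall M : 'rV[int]_d -> 'M[ratfun (ratfun K l) d]_r,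
        (forall v, M v \in unitmx /\
                   B *m map_mx (@emb_Kxz K d l) (M v) = SB v) ->
        conservative_matrix_field M].
Proof.
move=> B SB; have [[_ B_span] B_free] := B_basis.
have SBE v : SB v = map_mx (@shift_fracF K d l v) B.
  by apply/rowP => i; rewrite !mxE ore_act_mulS.
have row_free_B (c : 'I_r -> ratfun (ratfun K l) d) :
    \sum_i emb_Kxz (c i) * B 0 i = 0 -> forall i, c i = 0.
  move=> c0; apply: B_free; rewrite -[RHS]c0.
  by apply: eq_bigr => i _; rewrite mxE.
have M_ex v : exists M, B *m map_mx (@emb_Kxz K d l) M = SB v.
  (* Each entry of [SB v] is in the orbit, being the action of S_v b_i on f; its coordinates in the
     basis form column [i] of the matrix. *)
  have /fin_all_exists[c cP] i : exists c : 'I_r -> ratfun (ratfun K l) d,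
      SB v 0 i = \sum_j emb_Kxz (c j) * ore_act (b j) f%:F.
    by apply: B_span; exists (ore_mul (ore_S K l v) (b i)); rewrite mxE.
  exists (\matrix_(j, i) c i j); apply/rowP => i; rewrite cP mxE.
  by apply: eq_bigr => j _; rewrite !mxE mulrC.
have B_inj := free_row_mulmx_inj row_free_B.
have cocycle := semilinear_cocycle (@shift_fracFD K d l) (@shift_emb_Kxz K d l).
have M_unit := semilinear_cocycle_unit (@shift_fracF0 K d l)
  (@shift_fracFD K d l) (@shift_emb_Kxz K d l) row_free_B.
split=> [//|v|M M_eq].
  (* The matrix at [- v] serves to invert the one at [v]. *)
  have [M M_eq] := M_ex v; have [N N_eq] := M_ex (- v).
  exists M; split=> [|M' [_ M'_eq]]; last first.
    exact: B_inj (etrans M_eq (esym M'_eq)).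
  by split=> //; rewrite SBE in M_eq; rewrite SBE in N_eq; apply: M_unit M_eq N_eq.
split=> [v|v w]; first by case: (M_eq v).
have [[_ Mv] [_ Mw] [_ Mvw]] := And3 (M_eq v) (M_eq w) (M_eq (v + w)).
rewrite !SBE in Mv Mw Mvw.
exact: B_inj (etrans Mvw (esym (cocycle _ _ _ _ _ _ Mv Mw))).
Qed.
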